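(* Let $\{A_i \mid i \in I\}$ be an arbitrary nonempty indexed family of solvable groups, let $C$ be a group, and for each $i \in I$ let $\phi_i : C \to A_i$ be a monomorphism. Suppose that for all $i, j \in I$ there is an isomorphism $\theta_{ij} : A_i \to A_j$ such that $\theta_{ij} \circ \phi_i = \phi_j$. Then the generalized free product $G$ of the groups $A_i$ ($i \in I$) amalgamating $C$ via the monomorphisms $\phi_i$ is residually solvable.
   Context: The generalized free product of the $A_i$ amalgamating $C$ via monomorphisms $\phi_i : C \to A_i$ is the quotient of the free product of all the $A_i$ by the normal closure of the set $\{\phi_i(c)\,\phi_j(c)^{-1} : c \in C,\ i, j \in I\}$. A group $G$ is residually solvable if for every non-identity element $g \in G$ there is a homomorphism $\psi$ from $G$ to a solvable group such that $\psi(g) \neq 1$. *)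

(* Defs.v *)
(* Arbitrary, possibly infinite, groups are the [groupType]s of MathComp's
   [monoid]; their subsets are classical sets. *)
From HB Require Import structures.
From Stdlib Require Export Relation_Operators.
From mathcomp Require Export all_boot.
From mathcomp Require Export boolp classical_sets.

Set Implicit Arguments.
Unset Strict Implicit.
Unset Printing Implicit Defensive.

Local Open Scope quotient_scope.
Local Open Scope classical_set_scope.
Local Open Scope group_scope.

Notation "{ 'ghom' G -> H }" := (UMagmaMorphism.type G%type H%type)
  (at level 0, G at level 98, H at level 99,
   format "{ 'ghom'  G  ->  H }") : type_scope.

Section Subgroups.
Variable G : groupType.

Record is_subgroup (H : set G) : Prop := IsSubgroup {
  subgroup1 : H 1;
  subgroupM : forall x y, H x -> H y -> H (x * y);
  subgroupV : forall x, H x -> H x^-1 }.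

Record is_normal (N : set G) : Prop := IsNormal {
  normal_subgroup : is_subgroup N;
  normalJ : forall x g, N x -> N (x ^ g) }.

Definition generated (S : set G) : set G := smallest is_subgroup S.

Definition normal_closure (S : set G) : set G := smallest is_normal S.

Definition commutator_subgroup (H K : set G) : set G :=
  generated [set z | exists x y, [/\ H x, K y & z = [~ x, y]]].

Fixpoint derived_series (n : nat) : set G :=
  if n is m.+1 then commutator_subgroup (derived_series m) (derived_series m)
  else [set: G].

Definition solvable_group : Prop := exists n, derived_series n = [set 1].

Lemma normal_closure_normal (S : set G) : is_normal (normal_closure S).
Proof.
split; first split.
- by move=> N [/normal_subgroup /subgroup1].
- move=> x y Sx Sy N NS; case: (NS) => /normal_subgroup /subgroupM NM _.
  by apply: NM; [exact: Sx | exact: Sy].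
- move=> x Sx N NS; case: (NS) => /normal_subgroup /subgroupV NV _.
  by apply: NV; exact: Sx.
- by move=> x g Sx N NS; case: (NS) => /normalJ NJ _; apply: NJ; exact: Sx.
Qed.

End Subgroups.

Definition residually_solvable (G : groupType) : Prop :=
  forall g : G, g <> 1 ->
    exists (H : groupType) (psi : {ghom G -> H}),
      solvable_group H /\ psi g <> 1.

Section Quotient.
Variables (G : groupType) (N : set G) (nN : is_normal N).

Definition quotient_rel (x y : G) : bool := `[< N (x^-1 * y) >].

Lemma quotient_rel_refl : reflexive quotient_rel.
Proof. by move=> x; apply/asboolP; rewrite mulVg; case: nN => -[]. Qed.

Lemma quotient_rel_sym : symmetric quotient_rel.
Proof.
move=> x y; apply/asboolP/asboolP => /(subgroupV (normal_subgroup nN));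
  by rewrite invgM invgK.
Qed.

Lemma quotient_rel_trans : transitive quotient_rel.
Proof.
move=> y x z /asboolP Nxy /asboolP Nyz; apply/asboolP.
by have := subgroupM (normal_subgroup nN) Nxy Nyz; rewrite mulgA mulgK.
Qed.

Canonical quotient_equiv := EquivRel quotient_rel
  quotient_rel_refl quotient_rel_sym quotient_rel_trans.

Definition quotient_group : Type := {eq_quot quotient_equiv}.

HB.instance Definition _ := Choice.on quotient_group.

Definition quotient_proj (x : G) : quotient_group :=
  \pi_{eq_quot quotient_equiv} x.

Lemma quotient_projP x y :
  quotient_proj x = quotient_proj y <-> N (x^-1 * y).
Proof.
by split=> [/eqmodP/asboolP //|Nxy]; apply/eqmodP/asboolP.
Qed.

Lemma quotient_proj_repr (q : quotient_group) : quotient_proj (repr q) = q.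
Proof. exact: reprK. Qed.

Definition quotient_mul (p q : quotient_group) : quotient_group :=
  quotient_proj (repr p * repr q).
Definition quotient_inv (q : quotient_group) : quotient_group :=
  quotient_proj (repr q)^-1.

Lemma quotient_mulE x y :
  quotient_mul (quotient_proj x) (quotient_proj y) = quotient_proj (x * y).
Proof.
apply/quotient_projP; set x' := repr _; set y' := repr _.
have /quotient_projP Nx : quotient_proj x' = quotient_proj x.
  exact: quotient_proj_repr.
have /quotient_projP Ny : quotient_proj y' = quotient_proj y.
  exact: quotient_proj_repr.
have := subgroupM (normal_subgroup nN) Ny (normalJ nN y Nx).
by rewrite /conjg invgM !mulgA mulgK.
Qed.

Lemma quotient_invE x : quotient_inv (quotient_proj x) = quotient_proj x^-1.
Proof.
apply/quotient_projP; set x' := repr _.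
have /quotient_projP Nx : quotient_proj x = quotient_proj x'.
  by rewrite quotient_proj_repr.
have := normalJ nN x^-1 Nx.
by rewrite /conjg !invgK !mulgA mulgV mul1g.
Qed.

Lemma quotient_mulA : associative quotient_mul.
Proof.
move=> p q r; rewrite -(quotient_proj_repr p) -(quotient_proj_repr q).
by rewrite -(quotient_proj_repr r) !quotient_mulE mulgA.
Qed.

Lemma quotient_mul1 : left_id (quotient_proj 1) quotient_mul.
Proof. by move=> p; rewrite -(quotient_proj_repr p) quotient_mulE mul1g. Qed.

Lemma quotient_mulr1 : right_id (quotient_proj 1) quotient_mul.
Proof. by move=> p; rewrite -(quotient_proj_repr p) quotient_mulE mulg1. Qed.

Lemma quotient_mulV : left_inverse (quotient_proj 1) quotient_inv quotient_mul.
Proof.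
move=> p; rewrite -(quotient_proj_repr p) quotient_invE quotient_mulE.
by rewrite mulVg.
Qed.

Lemma quotient_mulrV :
  right_inverse (quotient_proj 1) quotient_inv quotient_mul.
Proof.
move=> p; rewrite -(quotient_proj_repr p) quotient_invE quotient_mulE.
by rewrite mulgV.
Qed.

HB.instance Definition _ := isGroup.Build quotient_group quotient_mulA
  quotient_mul1 quotient_mulr1 quotient_mulV quotient_mulrV.

Lemma quotient_projM : {morph quotient_proj : x y / x * y}.
Proof. by move=> x y; rewrite -[LHS]quotient_mulE. Qed.

HB.instance Definition _ :=
  isUMagmaMorphism.Build G quotient_group quotient_proj
    (erefl, quotient_projM).

End Quotient.

Section FreeProduct.
Variables (I : Type) (A : I -> groupType).

Definition word : Type := seq {i : I & A i}.

HB.instance Definition _ := gen_eqMixin word.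
HB.instance Definition _ := gen_choiceMixin word.

(* Elementary reductions of words: their equivalence closure is the congruence
   on the free monoid over the disjoint union of the [A i] whose quotient is
   the free product. *)
Inductive word_step : word -> word -> Prop :=
| word_step1 (u v : word) i :
    word_step (u ++ Tagged A (1 : A i) :: v) (u ++ v)
| word_stepM (u v : word) i (a b : A i) :
    word_step (u ++ Tagged A a :: Tagged A b :: v) (u ++ Tagged A (a * b) :: v).

Definition word_eq : word -> word -> Prop := clos_refl_sym_trans word word_step.

Definition word_rel (u v : word) : bool := `[< word_eq u v >].

Lemma word_rel_refl : reflexive word_rel.
Proof. by move=> u; apply/asboolP; exact: rst_refl. Qed.

Lemma word_rel_sym : symmetric word_rel.
Proof. by move=> u v; apply/asboolP/asboolP; exact: rst_sym. Qed.

Lemma word_rel_trans : transitive word_rel.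
Proof.
by move=> v u w /asboolP uv /asboolP vw; apply/asboolP; apply: rst_trans uv vw.
Qed.

Canonical word_equiv := EquivRel word_rel
  word_rel_refl word_rel_sym word_rel_trans.

Definition free_product : Type := {eq_quot word_equiv}.

HB.instance Definition _ := Choice.on free_product.

Definition word_class (u : word) : free_product := \pi_{eq_quot word_equiv} u.

Lemma word_classP u v : word_class u = word_class v <-> word_eq u v.
Proof. by split=> [/eqmodP/asboolP //|uv]; apply/eqmodP/asboolP. Qed.

Lemma word_class_repr (x : free_product) : word_class (repr x) = x.
Proof. exact: reprK. Qed.

Definition word_inv (u : word) : word :=
  rev [seq Tagged A (tagged x : A (tag x))^-1 | x <- u].

Lemma word_inv_cat u v : word_inv (u ++ v) = word_inv v ++ word_inv u.
Proof. by rewrite /word_inv map_cat rev_cat. Qed.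

Lemma word_inv_cons i (a : A i) u :
  word_inv (Tagged A a :: u) = word_inv u ++ [:: Tagged A a^-1].
Proof. by rewrite /word_inv /= rev_cons cats1. Qed.

Lemma word_eq_ctx u v l r : word_eq u v -> word_eq (l ++ u ++ r) (l ++ v ++ r).
Proof.
elim=> {u v} [u v|u|u v _|u v w _ uv _]; last exact: rst_trans.
- case=> [u' v' i|u' v' i a b]; apply: rst_step; rewrite -!catA !cat_cons.
    by rewrite !(catA l); apply: word_step1.
  by rewrite !(catA l); apply: word_stepM.
- exact: rst_refl.
- exact: rst_sym.
Qed.

Lemma word_eq_cat u u' v v' :
  word_eq u u' -> word_eq v v' -> word_eq (u ++ v) (u' ++ v').
Proof.
move=> uu' vv'; apply: (rst_trans _ _ _ (u' ++ v)).
  exact: (word_eq_ctx [::] v uu').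
by have := word_eq_ctx u' [::] vv'; rewrite !cats0.
Qed.

Lemma word_eq_inv u v : word_eq u v -> word_eq (word_inv u) (word_inv v).
Proof.
elim=> {u v} [u v|u|u v _|u v w _ uv _]; last exact: rst_trans.
- case=> [u' v' i|u' v' i a b]; apply: rst_step.
    rewrite !word_inv_cat word_inv_cons invg1 -catA /=.
    exact: word_step1.
  rewrite !word_inv_cat !word_inv_cons invgM -!catA /=.
  exact: word_stepM.
- exact: rst_refl.
- exact: rst_sym.
Qed.

Lemma word_eqV u : word_eq (word_inv u ++ u) [::].
Proof.
elim: u => [|[i a] u IHu]; first exact: rst_refl.
rewrite -/(Tagged A a) word_inv_cons -catA /=.
apply: rst_trans; first by apply: rst_step; apply: word_stepM.
rewrite mulVg; apply: rst_trans IHu; apply: rst_step; exact: word_step1.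
Qed.

Lemma word_invK : involutive word_inv.
Proof.
move=> u; rewrite /word_inv map_rev revK -map_comp -[RHS]map_id.
by apply: eq_map => -[i a] /=; rewrite invgK.
Qed.

Definition free_product_mul (x y : free_product) : free_product :=
  word_class (repr x ++ repr y).
Definition free_product_inv (x : free_product) : free_product :=
  word_class (word_inv (repr x)).

Lemma word_classM u v :
  free_product_mul (word_class u) (word_class v) = word_class (u ++ v).
Proof.
by apply/word_classP; apply: word_eq_cat; apply/word_classP;
  rewrite word_class_repr.
Qed.

Lemma word_classV u : free_product_inv (word_class u) = word_class (word_inv u).
Proof.
by apply/word_classP; apply: word_eq_inv; apply/word_classP;
  rewrite word_class_repr.
Qed.

Lemma free_product_mulA : associative free_product_mul.
Proof.
move=> x y z; rewrite -(word_class_repr x) -(word_class_repr y).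
by rewrite -(word_class_repr z) !word_classM catA.
Qed.

Lemma free_product_mul1 : left_id (word_class [::]) free_product_mul.
Proof. by move=> x; rewrite -(word_class_repr x) word_classM. Qed.

Lemma free_product_mulr1 : right_id (word_class [::]) free_product_mul.
Proof. by move=> x; rewrite -(word_class_repr x) word_classM cats0. Qed.

Lemma free_product_mulV :
  left_inverse (word_class [::]) free_product_inv free_product_mul.
Proof.
move=> x; rewrite -(word_class_repr x) word_classV word_classM.
by apply/word_classP; exact: word_eqV.
Qed.

Lemma free_product_mulrV :
  right_inverse (word_class [::]) free_product_inv free_product_mul.
Proof.
move=> x; rewrite -(word_class_repr x) word_classV word_classM.
by apply/word_classP; rewrite -{1}(word_invK (repr x)); exact: word_eqV.
Qed.

HB.instance Definition _ := isGroup.Build free_product free_product_mulA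
  free_product_mul1 free_product_mulr1 free_product_mulV free_product_mulrV.

Definition free_product_in (i : I) (a : A i) : free_product :=
  word_class [:: Tagged A a].

Lemma free_product_in_morphism i : monoid_morphism (@free_product_in i).
Proof.
split=> [|a b].
  by apply/word_classP; apply: rst_step; apply: (@word_step1 [::] [::]).
apply/esym; rewrite [LHS](word_classM [:: Tagged A a] [:: Tagged A b]).
apply/word_classP/rst_step.
exact: (@word_stepM [::] [::]).
Qed.

HB.instance Definition _ i := isUMagmaMorphism.Build (A i) free_product
  (@free_product_in i) (free_product_in_morphism i).

End FreeProduct.

Section Amalgam.
Variables (I : Type) (A : I -> groupType) (C : groupType).
Variable phi : forall i, {ghom C -> A i}.

Definition amalgam_relators : set (free_product A) :=
  [set x | exists (c : C) (i j : I),
    x = free_product_in (phi i c) * (free_product_in (phi j c))^-1].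

Definition amalgam : groupType :=
  quotient_group (normal_closure_normal amalgam_relators).

End Amalgam.

(* Main.v *)
(* Every reduced word a_1 ... a_n (n > 0) is shown to survive in a solvable
   quotient by induction on n: there are a solvable group H and compatible
   embeddings psi_i : A_i -> H under which no nonempty prefix of the word falls
   into the image of C.  For the empty word take H = A_i0 and the isomorphisms
   theta.  To prepend a letter a of A_k, replace H by the wreath product of Z/2
   by H and conjugate the single embedding psi_k by the indicator function of
   the image of C: this function commutes with C, so compatibility persists,
   and the base component of each new prefix takes the value 1 at psi_k(a)^-1. *)
From HB Require Import structures.
Require Import Defs.

Set Implicit Arguments.
Unset Strict Implicit.
Unset Printing Implicit Defensive.

Local Open Scope classical_set_scope.
Local Open Scope group_scope.

(** * Morphisms, derived series and solvable extensions with abelian kernel *)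

Definition ghom_of (G H : groupType) (f : G -> H) (fM : monoid_morphism f) :
  {ghom G -> H} := HB.pack f (isUMagmaMorphism.Build G H f fM).

Lemma trivial_subgroup (G : groupType) : is_subgroup [set (1 : G)].
Proof.
split=> //= [x y -> ->|x ->]; first by rewrite mulg1.
by rewrite invg1.
Qed.

Section GroupMorphisms.
Variables G H : groupType.

Lemma generated_subset (S N : set G) :
  is_subgroup N -> S `<=` N -> generated S `<=` N.
Proof. by move=> sN SN x; apply. Qed.

Lemma ghom_preim_subgroup (f : {ghom G -> H}) (N : set H) :
  is_subgroup N -> is_subgroup (f @^-1` N).
Proof.
move=> sN; split=> [|x y Nx Ny|x Nx] /=.
- by rewrite gmulf1; exact: subgroup1.
- by rewrite gmulfM; exact: subgroupM.
- by rewrite gmulfV; exact: subgroupV.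
Qed.

Lemma ghom_ker_normal (f : {ghom G -> H}) : is_normal (f @^-1` [set 1]).
Proof.
split; last first.
  by move=> x g /= fx; rewrite /conjg !gmulfM gmulfV fx mul1g mulVg.
exact/ghom_preim_subgroup/trivial_subgroup.
Qed.

End GroupMorphisms.

Lemma generated_subgroup (G : groupType) (S : set G) :
  is_subgroup (generated S).
Proof.
split.
- by move=> N [/subgroup1].
- move=> x y Sx Sy N [sN SN]; apply: subgroupM => //; first exact: Sx.
  exact: Sy.
- by move=> x Sx N [sN SN]; apply: subgroupV => //; exact: Sx.
Qed.

Lemma derived_series_subgroup (G : groupType) n :
  is_subgroup (derived_series (G := G) n).
Proof. by case: n => [|n] //=; exact: generated_subgroup. Qed.

Lemma ghom_derived_series (G H : groupType) (f : {ghom G -> H}) n :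
  derived_series n `<=` f @^-1` (derived_series n).
Proof.
elim: n => [//|n IHn]; apply: generated_subset.
  exact/ghom_preim_subgroup/derived_series_subgroup.
move=> _ [x [y [Gx Gy ->]]] N [_]; apply; exists (f x), (f y).
split; [exact: IHn | exact: IHn |].
by rewrite /commg /conjg !gmulfM !gmulfV.
Qed.

(** The [n]-th derived subgroup of [G] maps into that of [H], which is trivial, so it lies in the
    abelian kernel and its own commutators vanish. *)
Lemma solvable_abelian_ker (G H : groupType) (f : {ghom G -> H}) :
  (forall x y, f x = 1 -> f y = 1 -> x * y = y * x) ->
  solvable_group H -> solvable_group G.
Proof.
move=> kerC [n Hn]; exists n.+1; apply/seteqP; split; last first.
  by move=> _ ->; exact: (subgroup1 (@derived_series_subgroup G n.+1)).
apply: generated_subset; first exact: trivial_subgroup.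
move=> _ [x [y [Gx Gy ->]]] /=.
have ker z : derived_series n z -> f z = 1.
  by move=> /(@ghom_derived_series _ _ f); rewrite /= Hn.
by apply/eqP/commgP; apply: kerC; exact: ker.
Qed.

(** * The unrestricted wreath product of Z/2 by a group *)

Section Wreath.
Variable H : groupType.

Definition wreath : Type := ((H -> bool) * H)%type.

HB.instance Definition _ := gen_eqMixin wreath.
HB.instance Definition _ := gen_choiceMixin wreath.

(** [(+)] is the law of Z/2, and [h] acts on functions by right translation, sending [f] to
    [fun x => f (x * h)]. *)
Definition wreath_mul (p q : wreath) : wreath :=
  (fun x => p.1 x (+) q.1 (x * p.2), p.2 * q.2).
Definition wreath_one : wreath := (fun=> false, 1).
Definition wreath_inv (p : wreath) : wreath :=
  (fun x => p.1 (x * p.2^-1), p.2^-1).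

Lemma wreath_ext (p q : wreath) : p.1 =1 q.1 -> p.2 = q.2 -> p = q.
Proof. by case: p q => [f h] [f' h'] /= /funext -> ->. Qed.

Lemma wreath_mulA : associative wreath_mul.
Proof.
by move=> p q r; apply: wreath_ext => [x|] /=; rewrite ?addbA ?mulgA.
Qed.

Lemma wreath_mul1 : left_id wreath_one wreath_mul.
Proof.
by move=> p; apply: wreath_ext => [x|] /=; rewrite ?mulg1 ?mul1g.
Qed.

Lemma wreath_mulr1 : right_id wreath_one wreath_mul.
Proof.
by move=> p; apply: wreath_ext => [x|] /=; rewrite ?addbF ?mulg1.
Qed.

Lemma wreath_mulV : left_inverse wreath_one wreath_inv wreath_mul.
Proof.
by move=> p; apply: wreath_ext => [x|] /=; rewrite ?addbb ?mulVg.
Qed.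

Lemma wreath_mulrV : right_inverse wreath_one wreath_inv wreath_mul.
Proof.
by move=> p; apply: wreath_ext => [x|] /=; rewrite ?mulgK ?addbb ?mulgV.
Qed.

HB.instance Definition _ := isGroup.Build wreath wreath_mulA
  wreath_mul1 wreath_mulr1 wreath_mulV wreath_mulrV.

Definition wreath_top (p : wreath) : H := p.2.

Lemma wreath_top_morphism : monoid_morphism wreath_top.
Proof. by []. Qed.

HB.instance Definition _ := isUMagmaMorphism.Build wreath H wreath_top
  wreath_top_morphism.

Lemma wreath_solvable : solvable_group H -> solvable_group wreath.
Proof.
apply: (@solvable_abelian_ker _ _ wreath_top) => -[f h] [f' h'].
rewrite /wreath_top /= => -> ->.
by apply: wreath_ext => [x|//] /=; rewrite !mulg1 addbC.
Qed.

(* The conjugate [(m, 1) * (0, h) * (m, 1)^-1]. *)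
Definition wreath_conj (m : H -> bool) (h : H) : wreath :=
  (fun x => m x (+) m (x * h), h).

Lemma wreath_conj_morphism m : monoid_morphism (wreath_conj m).
Proof.
split=> [|g h]; apply: wreath_ext => [x|] //=; first by rewrite mulg1 addbb.
by rewrite mulgA addbA addbK.
Qed.

HB.instance Definition _ m := isUMagmaMorphism.Build H wreath
  (wreath_conj m) (wreath_conj_morphism m).

End Wreath.

(** * Universal properties of quotients and free products *)

Lemma quotient_lift (G H : groupType) (N : set G) (nN : is_normal N)
    (f : {ghom G -> H}) : N `<=` f @^-1` [set 1] ->
  exists g : {ghom quotient_group nN -> H},
    forall x, g (quotient_proj nN x) = f x.
Proof.
move=> Nf.
(* Since [f] kills [N], the chosen representative of a coset may stand for any of its elements. *)
have fE x : f (repr (quotient_proj nN x)) = f x.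
  have /quotient_projP/Nf/= : quotient_proj nN (repr (quotient_proj nN x)) =
    quotient_proj nN x by exact: quotient_proj_repr.
  rewrite gmulfM gmulfV => fxx.
  by rewrite -[RHS](mulVKg (f (repr (quotient_proj nN x)))) fxx mulg1.
have gM : monoid_morphism (fun q : quotient_group nN => f (repr q)).
  split=> [|p q]; first by rewrite [LHS]fE gmulf1.
  rewrite -(quotient_proj_repr p) -(quotient_proj_repr q).
  by rewrite -quotient_projM !fE gmulfM.
by exists (ghom_of gM) => x; exact: fE.
Qed.

Section WordEval.
Variables (I : Type) (A : I -> groupType) (H : groupType).
Variable psi : forall i, {ghom A i -> H}.

Definition word_eval (w : word A) : H :=
  \big[*%g/1]_(x <- w) psi (tag x) (tagged x).

Lemma word_eval_cons x w :
  word_eval (x :: w) = psi (tag x) (tagged x) * word_eval w.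
Proof. exact: big_cons. Qed.

Lemma word_eval1 x : word_eval [:: x] = psi (tag x) (tagged x).
Proof. exact: big_seq1. Qed.

Lemma word_eval_cat u v : word_eval (u ++ v) = word_eval u * word_eval v.
Proof. exact: big_cat. Qed.

Lemma word_eq_eval u v : word_eq u v -> word_eval u = word_eval v.
Proof.
elim=> {u v} [u v|//|u v _ -> //|u v w _ -> _ -> //].
case=> [u' v' i|u' v' i a b]; rewrite !word_eval_cat !word_eval_cons /=.
  by rewrite gmulf1 mul1g.
by rewrite gmulfM -!mulgA.
Qed.

Lemma free_product_lift : exists f : {ghom free_product A -> H},
  forall w, f (word_class w) = word_eval w.
Proof.
have fE w : word_eval (repr (word_class w)) = word_eval w.
  by apply/word_eq_eval/word_classP; exact: word_class_repr.
have fM : monoid_morphism (fun x : free_product A => word_eval (repr x)).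
  split=> [|x y]; first by rewrite [LHS]fE; exact: big_nil.
  by rewrite [LHS]fE word_eval_cat.
by exists (ghom_of fM) => w; exact: fE.
Qed.

End WordEval.

(** * Morphisms out of the amalgam and reduced words in it *)

Section Amalgam.
Variables (I : Type) (A : I -> groupType) (C : groupType).
Variable phi : forall i, {ghom C -> A i}.

Definition compatible (H : groupType) (psi : forall i, {ghom A i -> H}) :=
  forall c i j, psi i (phi i c) = psi j (phi j c).

Lemma amalgam_lift (H : groupType) (psi : forall i, {ghom A i -> H}) :
  compatible psi -> exists f : {ghom amalgam phi -> H},
    forall w, f (quotient_proj _ (word_class w)) = word_eval psi w.
Proof.
move=> cpsi; have [f fE] := free_product_lift psi.
have [|g gE] := @quotient_lift _ _ _
  (normal_closure_normal (amalgam_relators phi)) f; last first.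
  by exists g => w; rewrite gE.
move=> x; apply; split; first exact: ghom_ker_normal.
move=> _ [c [i [j ->]]] /=; rewrite gmulfM gmulfV !fE.
by rewrite !word_eval_cons /= (cpsi c i j) mulgV.
Qed.

Definition amalg_class (w : word A) : amalgam phi :=
  quotient_proj _ (word_class w).

Lemma amalg_class_surj g : exists w, amalg_class w = g.
Proof.
exists (repr (repr g)).
by rewrite /amalg_class word_class_repr quotient_proj_repr.
Qed.

Lemma amalg_class_cat u v :
  amalg_class (u ++ v) = amalg_class u * amalg_class v.
Proof.
by rewrite /amalg_class -quotient_projM -[X in quotient_proj _ X]word_classM.
Qed.

Lemma amalg_class1M i (a b : A i) :
  amalg_class [:: Tagged A a; Tagged A b] = amalg_class [:: Tagged A (a * b)].
Proof.
congr quotient_proj; apply/word_classP/rst_step.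
exact: (@word_stepM _ _ [::] [::]).
Qed.

Lemma amalg_class_phi c i j :
  amalg_class [:: Tagged A (phi i c)] = amalg_class [:: Tagged A (phi j c)].
Proof.
apply/esym/quotient_projP => N [nN]; apply.
(* The coset relation asks for [phi j c] inverted times [phi i c], which is the relator of [c^-1]
   for the pair [j, i]. *)
rewrite -[X in X * _](_ : free_product_in (phi j c^-1) = _).
  by exists c^-1, j, i; rewrite -gmulfV -gmulfV invgK.
by rewrite gmulfV gmulfV.
Qed.

Definition in_base (x : {i : I & A i}) : Prop :=
  exists c, tagged x = phi (tag x) c.

Definition mergeable (x y : {i : I & A i}) : Prop :=
  [\/ in_base x, in_base y | tag x = tag y].

(** A letter from [C] can be rewritten in the factor of its neighbour, after which the two letters
    multiply inside one [A i]. *)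
Lemma mergeableP x y : mergeable x y ->
  exists z, amalg_class [:: x; y] = amalg_class [:: z].
Proof.
rewrite -[[:: x; y]]/([:: x] ++ [:: y]) amalg_class_cat.
case: x y => i a [j b] [] /=.
- case=> c /= ->; rewrite (amalg_class_phi c i j) -amalg_class_cat.
  by eexists; exact: amalg_class1M.
- case=> c /= ->; rewrite (amalg_class_phi c j i) -amalg_class_cat.
  by eexists; exact: amalg_class1M.
- move=> ij; case: j / ij b => b; rewrite -amalg_class_cat.
  by eexists; exact: amalg_class1M.
Qed.

Fixpoint reduced (w : word A) : Prop :=
  if w is x :: w' then
    [/\ ~ in_base x, (if w' is y :: _ then tag x <> tag y else True)
      & reduced w']
  else True.

(** Only the first letter needs its own hypothesis: a later letter in [C] would merge with its
    predecessor. *)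
Lemma unmergeable_reduced x w : ~ in_base x ->
    (forall u y z v, x :: w = u ++ [:: y, z & v] -> ~ mergeable y z) ->
  reduced (x :: w).
Proof.
elim: w x => [//|y w IHw] x bx irr.
have xy := irr [::] x y w erefl.
split=> [//|xyE|]; first by apply: xy; constructor 3.
apply: IHw => [yb|u z t v wE]; first by apply: xy; constructor 2.
by apply: (irr (x :: u) z t v); rewrite wE.
Qed.

(* A single letter lying in [C] cannot be shortened, hence the disjunction. *)
Lemma amalg_class_reduced g :
  exists2 w, amalg_class w = g & reduced w \/ exists x, w = [:: x].
Proof.
have [w0 w0g] := amalg_class_surj g.
(* A word of least length representing [g] has no mergeable neighbours, since a merge would shorten
   it. *)
have : exists n, `[< exists2 w, amalg_class w = g & size w = n >].
  by exists (size w0); apply/asboolP; exists w0.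
case/ex_minnP => _ /asboolP[w wg <-] minw; exists w => //.
have {minw} irr u x y v : w = u ++ [:: x, y & v] -> ~ mergeable x y.
  move=> wE /mergeableP[z zE].
  suff /minw : `[< exists2 w', amalg_class w' = g
                             & size w' = size (u ++ z :: v) >].
    by rewrite wE !size_cat /= leq_add2l ltnn.
  apply/asboolP; exists (u ++ z :: v) => //.
  rewrite -wg wE -[z :: v]/([:: z] ++ v) -[[:: x, y & v]]/([:: x; y] ++ v).
  by rewrite !amalg_class_cat zE.
case: w {wg} irr => [|x [|y w]] irr; [by left | by right; exists x | left].
apply: unmergeable_reduced => // xb.
by apply: (irr [::] x y w) => //; constructor 1.
Qed.

(** * Separating a reduced word from [C] by twisting one embedding *)

Definition base_image (H : groupType) (psi : forall i, {ghom A i -> H}) : set H :=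
  [set h | exists c i, h = psi i (phi i c)].

(** The case [u = w] makes the value of a nonempty word nontrivial; the proper prefixes drive the
    induction in [conj_one_separated]. *)
Definition separating (H : groupType) (psi : forall i, {ghom A i -> H})
    (w : word A) : Prop :=
  forall u v, w = u ++ v -> u <> [::] -> ~ base_image psi (word_eval psi u).

Section ConjugateOne.
Variables (H : groupType) (psi : forall i, {ghom A i -> H}) (k : I).
Hypothesis psi_compatible : compatible psi.

(** For [b] false this is the zero function, and conjugation by it leaves the plain embedding of
    [H]; one formula thus covers twisted and untwisted indices. *)
Definition base_indicator (b : bool) (h : H) : bool :=
  b && `[< base_image psi h >].

Definition conj_one i : {ghom A i -> wreath H} :=
  wreath_conj (base_indicator `[< i = k >]) \o psi i.

(** The image of [C] is stable under right multiplication by its elements, so its indicator takes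
    equal values at [x] and [x * psi i (phi i c)], and these cancel. *)
Lemma conj_one_phi i c : conj_one i (phi i c) = (fun=> false, psi i (phi i c)).
Proof.
apply: wreath_ext => [x|//] /=; rewrite /base_indicator.
case: `[< i = k >] => //=.
suff -> : `[< base_image psi (x * psi i (phi i c)) >] = `[< base_image psi x >].
  by rewrite addbb.
apply/asboolP/asboolP => -[d [j]] => [/(canRL (mulgK _)) -> | ->].
  exists (d * c^-1), j; rewrite !gmulfM !gmulfV; congr (_ * _^-1).
  exact: psi_compatible.
by exists (d * c), j; rewrite !gmulfM (psi_compatible c i j).
Qed.

Lemma conj_one_compatible : compatible conj_one.
Proof. by move=> c i j; rewrite !conj_one_phi (psi_compatible c i j). Qed.

Lemma conj_one_top w : (word_eval conj_one w).2 = word_eval psi w.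
Proof.
elim: w => [|x w IHw]; first by rewrite /word_eval !big_nil.
by rewrite !word_eval_cons -IHw.
Qed.

Lemma base_image_conj_one p :
  base_image conj_one p -> p.1 =1 xpred0 /\ base_image psi p.2.
Proof. by case=> c [i ->]; rewrite conj_one_phi; split=> //; exists c, i. Qed.

(** Appending [y] adds [m h (+) m (h * psi y)], with [h] the value of the preceding prefix. If that
    prefix is nonempty, both arguments avoid the image of [C]; if it is empty, [y] is the first
    letter, so its tag is not [k] and [m] is zero. *)
Lemma conj_one_separated u :
    (if u is x :: _ then tag x <> k else True) -> separating psi u ->
  (word_eval conj_one u).1 1 = false.
Proof.
elim/last_ind: u => [|u y IHu] uk sep; first by rewrite /word_eval big_nil.
have sepu : separating psi u.
  by move=> v1 v2 uE; apply: (sep v1 (rcons v2 y)); rewrite uE rcons_cat.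
rewrite -cats1 word_eval_cat /= mul1g {}IHu //; last by case: (u) uk.
rewrite word_eval1 /= conj_one_top.
case: u uk sep sepu => [|x u] uk sep sepu.
  by rewrite /base_indicator; case: asboolP.
rewrite /base_indicator; case: `[< tag y = k >] => //=.
rewrite asboolF; last by apply: (sepu _ [::]); rewrite ?cats0.
rewrite asboolF //.
have := sep (rcons (x :: u) y) [::]; rewrite cats0 -cats1 word_eval_cat.
by rewrite word_eval1; apply.
Qed.

Lemma conj_one_separating x w : injective (psi (tag x)) -> tag x = k ->
    ~ in_base x -> (if w is y :: _ then tag x <> tag y else True) ->
  separating psi w -> separating conj_one (x :: w).
Proof.
move=> psi_inj xk xb xw sep [|_ u] v //= [<- wE] _ /base_image_conj_one[+ _].
have xb' : ~ base_image psi (psi (tag x) (tagged x)).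
  case=> c [j]; rewrite -(psi_compatible c (tag x) j) => /psi_inj xE.
  by apply: xb; exists c.
(* With [a] the value of [x], the base component at [a^-1] is [m (a^-1) (+) m 1] plus that of [u] at
   [1], that is 0 + 1 + 0, whereas elements of [C] give 0. *)
move/(_ (psi (tag x) (tagged x))^-1); rewrite word_eval_cons /= mulVg.
rewrite conj_one_separated; first last.
- by move=> u1 u2 uE; apply: (sep u1 (u2 ++ v)); rewrite wE uE catA.
- by case: u wE => // y u wE; rewrite wE /= in xw; rewrite -xk => /esym.
rewrite /base_indicator asboolT // addbF /= asboolF; last first.
  move=> [c [j /(canRL invgK) xE]]; apply: xb'; exists c^-1, j.
  by rewrite !gmulfV.
by rewrite asboolT //; exists 1, k; rewrite !gmulf1.
Qed.

End ConjugateOne.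

Lemma reduced_separating (H0 : groupType) (psi0 : forall i, {ghom A i -> H0}) w :
    solvable_group H0 -> compatible psi0 -> (forall i, injective (psi0 i)) ->
    reduced w ->
  exists (H : groupType) (psi : forall i, {ghom A i -> H}),
    [/\ solvable_group H, compatible psi, forall i, injective (psi i)
      & separating psi w].
Proof.
move=> solH0 compat0 inj0; elim: w => [_|x w IHw [xb xw /IHw]].
  by exists H0, psi0; split=> // -[|x u].
move=> [H [psi [solH compat inj sep]]].
(* The twist is at the factor of the new first letter. Injectivity persists because the top
   component is still [psi]. *)
exists (wreath H), (conj_one psi (tag x)); split.
- exact: wreath_solvable.
- exact: conj_one_compatible.
- by move=> i a b [_ /inj].
- exact: conj_one_separating.
Qed.

End Amalgam.

Theorem theorem4 (I : Type) (A : I -> groupType) (C : groupType)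
    (phi : forall i : I, {ghom C -> A i})
    (I_nonempty : inhabited I)
    (A_solvable : forall i : I, solvable_group (A i))
    (phi_inj : forall i : I, injective (phi i))
    (phi_iso : forall i j : I, exists theta : {ghom A i -> A j},
       bijective theta /\ (forall c : C, theta (phi i c) = phi j c)) :
  residually_solvable (amalgam phi).
Proof.
case: I_nonempty => o.
pose theta i := sval (cid (phi_iso i o)).
have thetaP i : bijective (theta i) /\ forall c, theta i (phi i c) = phi o c.
  exact: (svalP (cid (phi_iso i o))).
have compat : compatible phi theta.
  by move=> c i j; rewrite (thetaP i).2 (thetaP j).2.
have inj i : injective (theta i) by exact: bij_inj (thetaP i).1.
move=> g g1; have [w wg [red|[x wx]]] := amalg_class_reduced g; last first.
  (* A single letter may lie in [C], but it already survives in [A o], as [theta (tag x)] is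
     injective. *)
  have [f fE] := amalgam_lift compat; exists (A o), f; split=> //.
  rewrite -wg fE wx word_eval1.
  rewrite -(@gmulf1 _ _ (theta (tag x))) => /inj x1; apply: g1; rewrite -wg wx.
  case: x {wx} x1 => i a /= ->.
  rewrite /amalg_class -[word_class _]/(free_product_in 1).
  by rewrite gmulf1.
have [H [psi [solH compatH _ sep]]] :=
  reduced_separating (A_solvable o) compat inj red.
have [f fE] := amalgam_lift compatH; exists H, f; split=> //.
(* If the whole word had value 1, that value would be the image of [1] in [C], against
   separation. *)
rewrite -wg fE => w1; apply: (sep w [::]); rewrite ?cats0 //.
  by move=> w0; apply: g1; rewrite -wg w0.
by exists 1, o; rewrite w1 !gmulf1.
Qed.
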